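(* Let $n\ge2$ and $\mathcal{P}=\{x\in\mathbb{R}^n:\tfrac12(\max_i x_i-\min_i x_i)\le1\}$. The lattice of double-faces of $\mathcal{P}$ has the Sperner property, i.e., the maximum size of an antichain in it equals the maximum size of a rank level. Moreover, the set of all double-faces of $\mathcal{P}$ of dimension $\lfloor n/3\rfloor+1$ is an antichain of maximum size.
   Context: For a polyhedron $\mathcal{Q}$, a face is $\mathcal{Q}$, $\varnothing$, or a nonempty set $\mathcal{Q}\cap\{x:b^\top x=c\}$ where $b^\top x\le c$ for all $x\in\mathcal{Q}$; its dimension is that of its affine hull; a proper face is a face other than $\mathcal{Q}$ and $\varnothing$. For centrally symmetric $\mathcal{Q}$ ($\mathcal{Q}=-\mathcal{Q}$), a double-face is a set $F\cup -F$ with $F$ a proper face, and its dimension/rank is the dimension of $F$. The lattice of double-faces is the set of all double-faces together with $\mathcal{Q}$ (rank $n$) and $\varnothing$ (rank one less than the smallest dimension of a proper face), partially ordered by inclusion; it is graded by this rank, and a rank level is the set of all its elements of a given rank. An antichain is a set of pairwise incomparable elements. *)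

(* Defs.v *)
From HB Require Import structures.
From mathcomp Require Import all_boot all_order all_algebra.
From mathcomp Require Import classical_sets reals.
From Stdlib Require List.
Set Implicit Arguments. Unset Strict Implicit. Unset Printing Implicit Defensive.
Import Order.TTheory GRing.Theory Num.Theory.
Local Open Scope classical_set_scope.
Local Open Scope ring_scope.

Section Defs.
Variables (R : realType) (n : nat).
Local Notation V := 'rV[R]_n.

Definition dotv (b x : V) : R := \sum_(i < n) b 0 i * x 0 i.

(* max_i x_i and min_i x_i (the default x_{i0} is one of the values, so this is
   the true maximum/minimum for any i0) *)
Definition vmax (x : V) (i0 : 'I_n) : R := \big[Num.max/x 0 i0]_(i < n) x 0 i.
Definition vmin (x : V) (i0 : 'I_n) : R := \big[Num.min/x 0 i0]_(i < n) x 0 i.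

Definition Ppoly : set V :=
  [set x | forall i0 : 'I_n, (vmax x i0 - vmin x i0) / 2%:R <= 1].

Definition is_face (Q F : set V) : Prop :=
  F = Q \/ F = set0 \/
  (F <> set0 /\ exists (b : V) (c : R),
      (forall x, Q x -> dotv b x <= c) /\ F = [set x | Q x /\ dotv b x = c]).

Definition proper_face (Q F : set V) : Prop :=
  is_face Q F /\ F <> Q /\ F <> set0.

(* dimension of the affine hull of S: the dimension of the linear span of the
   differences x - y (x, y in S); such a span in R^n is spanned by n differences *)
Definition diffmx (S : set V) (M : 'M[R]_n) : Prop :=
  forall i : 'I_n, exists x y, S x /\ S y /\ row i M = x - y.

Definition affdim (S : set V) (d : nat) : Prop :=
  (exists M, diffmx S M /\ \rank M = d) /\
  (forall M, diffmx S M -> (\rank M <= d)%N).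

Definition negset (F : set V) : set V := [set x | F (- x)].

Definition double_face (Q D : set V) : Prop :=
  exists F, proper_face Q F /\ D = F `|` negset F.

Definition lat_elt (Q D : set V) : Prop := D = Q \/ D = set0 \/ double_face Q D.

Definition min_proper_dim (Q : set V) (m : nat) : Prop :=
  (exists F, proper_face Q F /\ affdim F m) /\
  (forall F d, proper_face Q F -> affdim F d -> (m <= d)%N).

Definition has_rank (Q D : set V) (r : int) : Prop :=
  (D = Q /\ r = n%:Z) \/
  (D = set0 /\ exists m : nat, min_proper_dim Q m /\ r = m%:Z - 1) \/
  (exists F d, proper_face Q F /\ D = F `|` negset F /\ affdim F d /\ r = d%:Z).

Definition rank_level (Q : set V) (r : int) : set (set V) :=
  [set D | lat_elt Q D /\ has_rank Q D r].

Definition lists_exactly (S : set (set V)) (l : list (set V)) : Prop :=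
  List.NoDup l /\ forall D, S D <-> List.In D l.

Definition antichain (Q : set V) (A : list (set V)) : Prop :=
  List.NoDup A /\ (forall D, List.In D A -> lat_elt Q D) /\
  (forall D E, List.In D A -> List.In E A -> D `<=` E -> D = E).

Definition double_faces_of_dim (Q : set V) (d : nat) : set (set V) :=
  [set D | exists F, proper_face Q F /\ D = F `|` negset F /\ affdim F d].

End Defs.

(* Main.v *)
(** The proper faces of the polytope correspond to sign vectors in which both
    signs occur: the face of [s] consists of the points whose maximum is attained
    (and exceeds the minimum by 2) at all positive coordinates of [s] and whose
    minimum is attained at all negative ones. Its dimension is [n + 1 - k], where
    [k] is the size of the support of [s], inclusion of faces reverses the order
    of sign vectors, and negation of a face negates [s], so that double-faces
    correspond to pairs [{s, -s}] and an antichain of double-faces lifts to an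
    antichain of sign vectors of twice its size.

    A sign vector of support size [k] has exactly [2(n - k)] upper covers, and it
    has at most [k] and, if [k >= 3], at least [k - 1] lower covers: at most one
    deletion kills a sign. With [K = n - n %/ 3], every vector of rank [k < K] has
    at least as many upper covers as a vector of rank [k + 1] has lower covers, and
    conversely for [k >= K]. By double counting, the shadow towards rank [K] of
    the extreme rank of an antichain is no smaller than that rank, so any
    antichain can be pushed into rank [K] without losing elements. *)
Require Import Defs.
From HB Require Import structures.
From mathcomp Require Import all_boot all_order all_algebra.
From mathcomp Require Import classical_sets reals.
From mathcomp Require Import zify lra.
From Stdlib Require List.
Import Order.TTheory GRing.Theory Num.Theory.
Set Implicit Arguments. Unset Strict Implicit. Unset Printing Implicit Defensive.

(** * Double counting and pushing antichains in a finite graded order *)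

(** The pairs related by [e] between [S] and [N] number at least [d * #|S|] and at most
    [d * #|N|]. *)
Lemma card_le_of_degree (T : finType) (e : rel T) (S N : {set T}) (d : nat) :
  (0 < d)%N ->
  (forall x, x \in S -> d <= #|[set y in N | e x y]|)%N ->
  (forall y, y \in N -> #|[set x in S | e x y]| <= d)%N ->
  (#|S| <= #|N|)%N.
Proof.
move=> d0 HS HN; rewrite -(leq_pmul2l d0).
have -> : (d * #|S| = \sum_(x in S) d)%N by rewrite sum_nat_const mulnC.
have -> : (d * #|N| = \sum_(x in N) d)%N by rewrite sum_nat_const mulnC.
apply: (@leq_trans (\sum_(x in S) #|[set y in N | e x y]|)); first exact: leq_sum.
apply: (@leq_trans (\sum_(y in N) #|[set x in S | e x y]|)); last exact: leq_sum.
under eq_bigr do rewrite -sum1dep_card big_mkcondr /=.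
under [X in (_ <= X)%N]eq_bigr do rewrite -sum1dep_card big_mkcondr /=.
by rewrite exchange_big.
Qed.

Definition antichain_set (T : finType) (le : rel T) (A : {set T}) : Prop :=
  forall x y, x \in A -> y \in A -> le x y -> x = y.

(* Replaces the lowest elements of the antichain by their upper covers, rank after rank, up to K. *)
Lemma push_up (T : finType) (le e : rel T) (rk : T -> nat) (V : {set T}) (K : nat) :
  transitive le ->
  (forall x y, x \in V -> y \in V -> le x y -> rk y <= rk x -> x = y)%N ->
  (forall x y, e x y -> le x y /\ rk y = (rk x).+1) ->
  (forall k, (k < K)%N -> exists d, [/\ (0 < d)%N,
     forall x, x \in V -> rk x = k -> (d <= #|[set y in V | e x y]|)%N &
     forall y, y \in V -> rk y = k.+1 -> (#|[set x in V | e x y]| <= d)%N]) ->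
  forall A : {set T}, A \subset V -> antichain_set le A ->
  exists A' : {set T}, [/\ A' \subset V, antichain_set le A', (#|A| <= #|A'|)%N,
    forall x, x \in A' -> (K <= rk x)%N &
    forall M, (K <= M)%N -> (forall x, x \in A -> rk x <= M)%N ->
      forall x, x \in A' -> (rk x <= M)%N].
Proof.
move=> le_tr le_rk e_le deg A AV AA.
suff H j : (j <= K)%N -> exists A' : {set T}, [/\ A' \subset V, antichain_set le A', (#|A| <= #|A'|)%N,
    forall x, x \in A' -> (j <= rk x)%N &
    forall M, (K <= M)%N -> (forall x, x \in A -> rk x <= M)%N ->
      forall x, x \in A' -> (rk x <= M)%N] by exact: H.
elim: j => [_|j IH jK]; first by exists A; split.
have [B [BV BA AB Bj BM]] := IH (ltnW jK).
pose S := [set x in B | rk x == j].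
pose N := [set y in V | [exists x in S, e x y]].
have SP x : x \in S -> [/\ x \in B, x \in V & rk x = j].
  by rewrite inE => /andP[xB /eqP xj]; split=> //; apply: (fintype.subsetP BV).
have NP y : y \in N -> [/\ y \in V, rk y = j.+1 & exists2 x, x \in S & le x y].
  rewrite inE => /andP[yV /existsP[x /andP[xS exy]]].
  have [lexy ry] := e_le _ _ exy; have [_ _ xj] := SP _ xS.
  by split=> //; [rewrite ry xj | exists x].
have CP y : y \in B :\: S -> y \in B /\ (j < rk y)%N.
  rewrite !inE => /andP[h yB]; split=> //.
  by rewrite yB /= in h; rewrite ltn_neqAle eq_sym h Bj.
have SB : S \subset B by apply/fintype.subsetP => x /SP[].
have [d [d0 dup ddown]] := deg _ jK.
have SN : (#|S| <= #|N|)%N.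
  apply: (@card_le_of_degree _ e _ _ _ d0) => [x xS|y yN].
    have [xB xV xj] := SP _ xS; apply: leq_trans (dup _ xV xj) _.
    apply/subset_leq_card/fintype.subsetP => y; rewrite inE => /andP[yV exy].
    by rewrite inE exy andbT inE yV /=; apply/existsP; exists x; rewrite xS.
  have [yV yj _] := NP _ yN; apply: leq_trans (ddown _ yV yj).
  apply/subset_leq_card/fintype.subsetP => x; rewrite inE => /andP[/SP[_ xV _] exy].
  by rewrite inE xV.
(* Some [x] in [S] lies below [y], so [le y z] would make [x] and [z] comparable in [B], although
   their ranks differ. *)
have NC y z : y \in N -> z \in B :\: S -> ~ le y z.
  move=> /NP[yV yj [x xS xy]] /CP[zB zj] yz; have [xB _ xj] := SP _ xS.
  have := BA _ _ xB zB (le_tr _ _ _ xy yz) => xz; by rewrite -xz xj ltnn in zj.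
exists ((B :\: S) :|: N); split.
- apply/fintype.subsetP => x; rewrite inE => /orP[/CP[xB _]|/NP[]//].
  exact: (fintype.subsetP BV).
- move=> y z; rewrite [y \in _]inE [z \in _]inE => /orP[yC|yN] /orP[zC|zN] lyz.
  + by apply: BA => //; [case/CP: yC | case/CP: zC].
  + have [zV zj _] := NP _ zN; have [yB yj] := CP _ yC.
    by apply: le_rk; rewrite ?zj // (fintype.subsetP BV).
  + by case: (NC _ _ yN zC).
  + have [zV zj _] := NP _ zN; have [yV yj _] := NP _ yN.
    by apply: le_rk; rewrite ?zj ?yj.
- apply: leq_trans AB _; rewrite cardsU.
  have -> : (B :\: S) :&: N = finset.set0.
    apply/finset.setP => y; rewrite finset.inE finset.in_set0.
    apply/negbTE/negP => /andP[yC yN].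
    have [_ yj [x xS xy]] := NP _ yN; have [yB _] := CP _ yC; have [xB _ xj] := SP _ xS.
    by have xey := BA _ _ xB yB xy; rewrite -xey xj in yj; lia.
  rewrite cards0 subn0 cardsD (finset.setIidPr SB).
  have := subset_leq_card SB; lia.
- by move=> x; rewrite inE => /orP[/CP[]//|/NP[_ -> _]].
- move=> M KM AM x; rewrite inE => /orP[/CP[xB _]|/NP[_ -> _]]; last exact: leq_trans KM.
  exact: BM.
Qed.

(** Push up to rank at least [K], then push again in the reversed order with rank [n - rk x]. The
    last clause of [push_up] keeps the second pass from dropping below [K]. *)
Lemma antichain_le_level (T : finType) (le e : rel T) (rk : T -> nat) (V : {set T}) (n K : nat) :
  transitive le ->
  (forall x, rk x <= n)%N -> (K <= n)%N ->
  (forall x y, x \in V -> y \in V -> le x y -> rk y <= rk x -> x = y)%N ->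
  (forall x y, e x y -> le x y /\ rk y = (rk x).+1) ->
  (forall k, (k < K)%N -> exists d, [/\ (0 < d)%N,
     forall x, x \in V -> rk x = k -> (d <= #|[set y in V | e x y]|)%N &
     forall y, y \in V -> rk y = k.+1 -> (#|[set x in V | e x y]| <= d)%N]) ->
  (forall k, (K <= k < n)%N -> exists d, [/\ (0 < d)%N,
     forall y, y \in V -> rk y = k.+1 -> (d <= #|[set x in V | e x y]|)%N &
     forall x, x \in V -> rk x = k -> (#|[set y in V | e x y]| <= d)%N]) ->
  forall A : {set T}, A \subset V -> antichain_set le A ->
  (#|A| <= #|[set x in V | rk x == K]|)%N.
Proof.
move=> le_tr rkn Kn le_rk e_le degup degdown A AV AA.
have [B [BV BA AB BK _]] := push_up le_tr le_rk e_le degup AV AA.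
have := @push_up T (fun x y => le y x) (fun x y => e y x) (fun x => n - rk x)%N V (n - K)%N.
case/(_ _ _ _ _ B BV).
- by move=> y x z /= h1 h2; apply: le_tr h2 h1.
- move=> x y xV yV lyx h; apply/esym/le_rk => //.
  by have := rkn x; have := rkn y; lia.
- move=> x y eyx; have [lyx rx] := e_le _ _ eyx; split=> //.
  by have := rkn x; have := rkn y; lia.
- move=> k kK; have [|d [d0 h1 h2]] := degdown (n - k.+1)%N; first lia.
  exists d; split=> // x xV hx; have := rkn x => ?; [apply: h1 | apply: h2] => //; lia.
- by move=> x y xB yB lyx; apply/esym/BA.
move=> C [CV CA BC CK CM]; apply: leq_trans AB (leq_trans BC _).
apply/subset_leq_card/fintype.subsetP => x xC; rewrite inE (fintype.subsetP CV) //=.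
have h1 := CK _ xC; have := rkn x => ?.
have := CM _ (leqnn _) _ _ xC => h2; apply/eqP.
suff: (n - rk x <= n - K)%N by lia.
by apply: h2 => y /BK; lia.
Qed.

(** * Sign vectors: order, covers and the antichain bound *)

Section SignVectors.
Variable I : finType.
Implicit Types s t : {ffun I -> option bool}.

Definition upd s (i : I) (v : option bool) := [ffun j => if j == i then v else s j].
Definition supp s : {set I} := [set i | s i != None].
Definition sneg s := [ffun i => omap negb (s i)].
Definition sle s t := [forall i, (s i == None) || (s i == t i)].
Definition cover s t := [exists i, (t i != None) && (s == upd t i None)].

(* The sign vectors indexing the proper faces: both signs have to occur. *)
Definition mixed : {set {ffun I -> option bool}} :=
  [set s : {ffun I -> option bool} | [forall b, [exists i, s i == Some b]]].

Lemma mixedP s : reflect (forall b, exists i, s i = Some b) (s \in mixed).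
Proof.
rewrite inE; apply: (iffP forallP) => [h b|h b].
  by have /existsP[i /eqP] := h b; exists i.
by have [i hi] := h b; apply/existsP; exists i; rewrite hi.
Qed.

Lemma sleP s t : reflect (forall i, s i != None -> s i = t i) (sle s t).
Proof.
apply: (iffP forallP) => h i; first by case/orP: (h i) => [->//|/eqP].
by case: eqP => //= /eqP /h ->.
Qed.

Lemma sle_trans : transitive sle.
Proof.
move=> t s u /sleP st /sleP tu; apply/sleP => i si.
by rewrite (st _ si) tu // -st.
Qed.

Lemma sle_card_inj s t : sle s t -> (#|supp t| <= #|supp s|)%N -> s = t.
Proof.
move=> /sleP st ts; have ss : supp s \subset supp t.
  by apply/fintype.subsetP => i; rewrite !inE => si; rewrite -st.
have /eqP E : supp s == supp t by rewrite eqEcard ss.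
apply/ffunP => i; case: (eqVneq (s i) None) => [si|/st//].
have : i \in supp t = false by rewrite -E inE si.
by rewrite inE si => /negbFE/eqP.
Qed.

Lemma snegK : involutive sneg.
Proof. by move=> s; apply/ffunP => i; rewrite !ffunE; case: (s i) => // b; rewrite /= negbK. Qed.

Lemma supp_sneg s : supp (sneg s) = supp s.
Proof. by apply/finset.setP => i; rewrite !inE ffunE; case: (s i). Qed.

Lemma mixed_sneg s : (sneg s \in mixed) = (s \in mixed).
Proof.
suff h t : t \in mixed -> sneg t \in mixed.
  by apply/idP/idP => [/h|/h//]; rewrite snegK.
move=> /mixedP ht; apply/mixedP => b; have [i hi] := ht (~~ b).
by exists i; rewrite ffunE hi /= negbK.
Qed.

Lemma sneg_not_le s : s \in mixed -> ~~ sle s (sneg s).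
Proof.
move=> /mixedP/(_ true)[i si]; apply/negP => /sleP/(_ i).
by rewrite ffunE si => /(_ isT).
Qed.

Lemma supp_upd_None t i : supp (upd t i None) = supp t :\ i.
Proof. by apply/finset.setP => j; rewrite !inE ffunE; case: (j == i). Qed.

Lemma coverP s t : reflect (exists2 i, t i != None & s = upd t i None) (cover s t).
Proof.
apply: (iffP existsP) => [[i /andP[ti /eqP]]|[i ti ->]]; exists i => //.
by rewrite ti eqxx.
Qed.

Lemma cover_sle s t : cover s t -> sle s t /\ #|supp t| = #|supp s|.+1.
Proof.
case/coverP => i ti ->; split.
  by apply/sleP => j; rewrite !ffunE; case: (j == i).
by rewrite supp_upd_None (cardsD1 i (supp t)) inE ti.
Qed.

Lemma card_lower_covers_le t : (#|[set s in mixed | cover s t]| <= #|supp t|)%N.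
Proof.
apply: leq_trans (leq_imset_card (fun i => upd t i None) (mem (supp t))).
apply/subset_leq_card/fintype.subsetP => s; rewrite inE => /andP[_ /coverP[i ti ->]].
by apply/imsetP; exists i; rewrite ?inE.
Qed.

Lemma card_lower_covers_ge t : t \in mixed -> (3 <= #|supp t|)%N ->
  (#|supp t|.-1 <= #|[set s in mixed | cover s t]|)%N.
Proof.
move=> /mixedP tm t3; have [i ti] := tm true; have [j tj] := tm false.
(* A third support position [k] repeats the sign at [i] or at [j]. The other of these two positions
   is [l], the only one whose deletion can kill a sign. *)
have [k kS /andP[ki kj]] : exists2 k, k \in supp t & (k != i) && (k != j).
  have : (0 < #|supp t :\ i :\ j|)%N.
    have := cardsD1 i (supp t); have := cardsD1 j (supp t :\ i).
    by case: (_ \in _) (_ \in _) => [] []; lia.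
  by case/card_gt0P => k; rewrite 2!finset.in_setD1 => /and3P[? ? ?]; exists k => //; apply/andP.
have [l lS lP] : exists2 l, l \in supp t & forall m, m != l -> upd t m None \in mixed.
  move: kS; rewrite inE; case tk: (t k) => [[]|] // _.
  - exists j => [|m mj]; first by rewrite inE tj.
    apply/mixedP => -[]; last by exists j; rewrite ffunE eq_sym (negbTE mj).
    case: (eqVneq i m) => [im|im]; last by exists i; rewrite ffunE (negbTE im).
    by exists k; rewrite ffunE -im (negbTE ki).
  - exists i => [|m mi]; first by rewrite inE ti.
    apply/mixedP => -[]; first by exists i; rewrite ffunE eq_sym (negbTE mi).
    case: (eqVneq j m) => [jm|jm]; last by exists j; rewrite ffunE (negbTE jm).
    by exists k; rewrite ffunE -jm (negbTE kj).
have -> : #|supp t|.-1 = #|supp t :\ l| by rewrite (cardsD1 l) lS.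
rewrite -(@card_in_imset _ _ (fun m => upd t m None)); last first.
  move=> m m'; rewrite 2!finset.in_setD1 => /andP[_ mS] /andP[_ m'S] /ffunP/(_ m).
  rewrite !ffunE eqxx; case: eqP => // _ tm0.
  by rewrite inE -tm0 in mS.
apply/subset_leq_card/fintype.subsetP => s /imsetP[m]; rewrite finset.in_setD1 => /andP[ml mS] ->.
by rewrite inE lP //=; apply/coverP; exists m => //; rewrite inE in mS.
Qed.

(** An upper cover is determined by a position outside the support and one of two signs for it. *)
Lemma card_upper_covers_le s : (#|[set t in mixed | cover s t]| <= 2 * (#|I| - #|supp s|))%N.
Proof.
have <- : #|finset.setX (~: supp s) [set: bool]| = (2 * (#|I| - #|supp s|))%N.
  by rewrite cardsX cardsT card_bool -(cardsC (supp s)) addKn mulnC.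
apply: leq_trans (leq_imset_card (fun p => upd s p.1 (Some p.2)) _).
apply/subset_leq_card/fintype.subsetP => t; rewrite inE => /andP[_ /coverP[i ti ->]].
case E: (t i) ti => [b|] // _; apply/imsetP; exists (i, b).
  by rewrite !inE ffunE eqxx.
by apply/ffunP => j; rewrite !ffunE; case: eqP => // ->.
Qed.

Lemma card_upper_covers_ge s : s \in mixed ->
  (2 * (#|I| - #|supp s|) <= #|[set t in mixed | cover s t]|)%N.
Proof.
move=> sm; have <- : #|finset.setX (~: supp s) [set: bool]| = (2 * (#|I| - #|supp s|))%N.
  by rewrite cardsX cardsT card_bool -(cardsC (supp s)) addKn mulnC.
rewrite -(@card_in_imset _ _ (fun p => upd s p.1 (Some p.2))); last first.
  move=> [i b] [j c]; rewrite !inE !andbT !negbK => /eqP si /eqP sj /ffunP/(_ i).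
  rewrite !ffunE eqxx /=; case: eqP => [-> [->]//|_]; by rewrite si.
apply/subset_leq_card/fintype.subsetP => t /imsetP[[i b]]; rewrite !inE andbT negbK /= => /eqP si ->.
apply/andP; split.
  have /mixedP sm' := sm.
  apply/forallP => c; have [j sj] := sm' c; apply/existsP; exists j.
  rewrite ffunE; case: (j =P i) => [ji|_]; last by rewrite sj.
  by rewrite -ji sj in si.
apply/coverP; exists i; first by rewrite ffunE eqxx.
by apply/ffunP => j; rewrite !ffunE; case: eqP => // ->.
Qed.

Lemma mixed_antichain_bound (A : {set {ffun I -> option bool}}) :
  (2 <= #|I|)%N -> A \subset mixed -> antichain_set sle A ->
  (#|A| <= #|[set s in mixed | #|supp s| == #|I| - #|I| %/ 3]|)%N.
Proof.
move=> n2; apply: (@antichain_le_level _ sle cover (fun s => #|supp s|) mixed #|I|).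
- exact: sle_trans.
- by move=> s; apply: max_card.
- exact: leq_subr.
- by move=> s t _ _; apply: sle_card_inj.
- exact: cover_sle.
(* With [n = #|I|], [k < n - n %/ 3] gives [3 * k < 2 * n], hence [k.+1 <= 2 * (n - k)]. *)
- move=> k kK; exists (2 * (#|I| - k))%N; split; first lia.
    by move=> s sm <-; apply: card_upper_covers_ge.
  move=> t _ tk; apply: leq_trans (card_lower_covers_le t) _; rewrite tk; lia.
(* Now [3 * k >= 2 * n], hence [2 * (n - k) <= k]. Also [k >= 2], so rank [k.+1] is at least 3, as
   the lower bound on lower covers requires. *)
- move=> k /andP[Kk kn]; exists k; split; first lia.
    move=> t tm tk; have := card_lower_covers_ge tm; rewrite tk; apply; lia.
  move=> s _ sk; apply: leq_trans (card_upper_covers_le s) _; rewrite sk; lia.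
Qed.

End SignVectors.

(** * Faces of the polytope and their dimensions *)

Local Open Scope classical_set_scope.
Local Open Scope ring_scope.

(** The row space lies in the sum of the lines spanned by the rows indexed by [U]. *)
Lemma mxrank_le_nonzero_rows (F : fieldType) (m n : nat) (A : 'M[F]_(m, n)) (U : {set 'I_m}) :
  (forall i, i \notin U -> row i A = 0) -> (\rank A <= #|U|)%N.
Proof.
move=> AU; have /mxrankS/leq_trans -> // : (A <= \sum_(i in U) <<row i A>>)%MS.
  apply/row_subP => i; have [iU|/AU ->] := boolP (i \in U); last exact: sub0mx.
  by apply: (sumsmx_sup i) => //; rewrite genmxE.
rewrite -sum1_card.
elim/big_ind2: _ => [|B p C q Bp Cq|i _]; first by rewrite mxrank0.
  by apply: leq_trans (mxrank_adds_leqif B C) _; apply: leq_add.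
by rewrite genmxE rank_leq_row.
Qed.

Section Geometry.
Variables (R : realType) (n : nat).
Local Notation V := 'rV[R]_n.
Local Notation signs := {ffun 'I_n -> option bool}.
Implicit Types s t : signs.

Definition sign_val (v : option bool) : R := if v is Some b then (if b then 1 else -1) else 0.
(** A generic point of [face s]: for mixed [t] it lies on [face t] only if [sle t s], so inclusions
    of faces can be tested on it alone. *)
Definition signpt s : V := \row_i sign_val (s i).

(* For [s] without nonzero signs this is the whole polytope: take for [c] the midrange of [x]. *)
Definition face s : set V := [set x | exists c, forall i,
  match s i with
  | Some true => x 0 i = c + 1
  | Some false => x 0 i = c - 1
  | None => c - 1 <= x 0 i <= c + 1
  end].

Definition dface s : set V := face s `|` negset (face s).

Lemma faceP s (x : V) : face s x -> exists c, forall i, c - 1 <= x 0 i <= c + 1.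
Proof. by move=> [c h]; exists c => i; move: (h i); case: (s i) => [[]|] //; lra. Qed.

Lemma Ppoly_face : (0 < n)%N -> @Ppoly R n = face [ffun => None].
Proof.
move=> n0; apply/seteqP; split => x /=.
  move=> /(_ (Ordinal n0)); rewrite ler_pdivrMr // mul1r => h.
  (* The coordinates spread over at most 2, so the interval of length 2 starting at the minimum
     contains them all. *)
  exists (vmin x (Ordinal n0) + 1) => i; rewrite ffunE.
  have h1 : x 0 i <= vmax x (Ordinal n0) by apply: (@le_bigmax _ _ _ _ (fun i => x 0 i)).
  have h2 : vmin x (Ordinal n0) <= x 0 i by apply: (@bigmin_le _ _ _ _ _ (fun i => x 0 i)).
  by lra.
move=> /faceP[c h] i0; rewrite ler_pdivrMr // mul1r.
have : vmax x i0 <= c + 1.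
  by apply: bigmax_le => [|i _]; [have := h i0 | have := h i]; lra.
have : c - 1 <= vmin x i0.
  by apply: le_bigmin => [|i _]; [have := h i0 | have := h i]; lra.
by lra.
Qed.

Lemma sle_face s t : sle s t -> face t `<=` face s.
Proof.
move=> /sleP st x /= [c h]; exists c => i; have := h i; have := st i.
by case: (s i) => [b /(_ isT) <-|_] //; case: (t i) => [[]|] //; lra.
Qed.

Lemma face_signpt s : face s (signpt s).
Proof. by exists 0 => i; rewrite mxE; case: (s i) => [[]|] /=; lra. Qed.

Lemma face_sneg s : face (sneg s) = negset (face s).
Proof.
apply/seteqP; split => x [c h]; exists (- c) => i; move: (h i); rewrite ffunE ?mxE.
  by case: (s i) => [[]|] /=; lra.
by case: (s i) => [[]|] /=; lra.
Qed.

Lemma sign_val_inj : injective sign_val.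
Proof. by move=> [[]|] [[]|] //= h; exfalso; lra. Qed.

Lemma signpt_face s t : t \in mixed 'I_n -> face t (signpt s) -> sle t s.
Proof.
move=> /mixedP tm [c h]; have [i ti] := tm true; have [j tj] := tm false.
(* The entries of [signpt s] lie between -1 and 1, and [t] forces both [c + 1] and [c - 1] to occur
   among them. *)
have c0 : c = 0.
  move: (h i) (h j); rewrite ti tj !mxE.
  by case: (s i) => [[]|] /=; case: (s j) => [[]|] /=; lra.
apply/sleP => k tk; move: (h k); rewrite mxE c0; case: (t k) tk => [[]|] // _ hk.
  by apply: sign_val_inj; rewrite hk /=; lra.
by apply: sign_val_inj; rewrite hk /=; lra.
Qed.

Lemma dface_sneg s : dface (sneg s) = dface s.
Proof. by rewrite /dface -face_sneg snegK face_sneg setUC. Qed.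

Lemma dface_sub s t : t \in mixed 'I_n -> dface s `<=` dface t -> sle t s \/ sle (sneg t) s.
Proof.
move=> tm sub; case: (sub (signpt s)); first by left; apply: face_signpt.
  by left; apply: signpt_face.
by rewrite -face_sneg => h; right; apply: signpt_face => //; rewrite mixed_sneg.
Qed.

Lemma sle_dface s t : sle s t -> dface t `<=` dface s.
Proof.
by move=> st x [] h; [left | right]; apply: (sle_face st).
Qed.

Lemma dface_sub_inj s t : t \in mixed 'I_n -> (#|supp s| <= #|supp t|)%N ->
  dface s `<=` dface t -> s = t \/ s = sneg t.
Proof.
move=> tm st /(dface_sub tm) [] h; [left|right]; apply/esym/sle_card_inj => //.
by rewrite supp_sneg.
Qed.

Lemma dface_inj s t : s \in mixed 'I_n -> t \in mixed 'I_n ->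
  dface s = dface t -> s = t \/ s = sneg t.
Proof.
move=> sm tm E; have [st|st] := leqP #|supp s| #|supp t|.
  by apply: dface_sub_inj => //; rewrite E.
have [|||->|->] := @dface_sub_inj t s; rewrite ?(ltnW st) ?E //; first by left.
by right; rewrite snegK.
Qed.

Lemma dface_sub_Ppoly s : (0 < n)%N -> dface s `<=` @Ppoly R n.
Proof.
move=> n0; have h t : face t `<=` @Ppoly R n.
  by rewrite Ppoly_face //; apply: sle_face; apply/sleP => i; rewrite ffunE.
by move=> x [/h //|]; rewrite -face_sneg => /h.
Qed.

Definition sign_of (b : V) : signs :=
  [ffun i => if 0 < b 0 i then Some true else if b 0 i < 0 then Some false else None].

(** A zero-sum functional ignores multiples of the all-ones vector, so a point of the polytope can
    be recentred to have entries between -1 and 1. *)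
Lemma dotv_shift (b x : V) c : \sum_i b 0 i = 0 ->
  dotv b x = \sum_i b 0 i * (x 0 i - c).
Proof.
move=> b0; under [RHS]eq_bigr do rewrite mulrBr.
by rewrite sumrB -mulr_suml b0 mul0r subr0.
Qed.

Lemma dotv_le_norm (b x : V) : (0 < n)%N -> \sum_i b 0 i = 0 ->
  @Ppoly R n x -> dotv b x <= \sum_i `|b 0 i|.
Proof.
move=> n0 b0; rewrite Ppoly_face // => /faceP[c h].
rewrite (dotv_shift _ c b0); apply: ler_sum => i _; apply: le_trans (ler_norm _) _.
by rewrite normrM ler_piMr // ler_norml; have := h i; lra.
Qed.

(** Equality in the bound [dotv_le_norm] forces equality in each term, which fixes [x 0 i - c] to be
    the sign of [b 0 i] wherever that entry is nonzero. *)
Lemma face_sign_of (b : V) : (0 < n)%N -> \sum_i b 0 i = 0 ->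
  face (sign_of b) = [set x | @Ppoly R n x /\ dotv b x = \sum_i `|b 0 i|].
Proof.
move=> n0 b0; apply/seteqP; split => x /= => [fx|[]].
  split; first by rewrite Ppoly_face //; move: x fx; apply: sle_face; apply/sleP => i; rewrite ffunE.
  case: fx => c h; rewrite (dotv_shift _ c b0); apply: eq_bigr => i _.
  move: (h i); rewrite ffunE; case: ltrgt0P => bi; first by move=> ->; lra.
    by move=> ->; lra.
  by rewrite bi mul0r.
rewrite Ppoly_face // => /faceP[c h]; rewrite (dotv_shift _ c b0) => E.
have F i : `|b 0 i| - b 0 i * (x 0 i - c) = 0.
  apply: (@psumr_eq0P _ _ predT (fun i => `|b 0 i| - b 0 i * (x 0 i - c))) => // [j _|].
    rewrite subr_ge0; apply: le_trans (ler_norm _) _.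
    by rewrite normrM ler_piMr // ler_norml; have := h j; lra.
  by rewrite sumrB E subrr.
exists c => i; move: (F i); rewrite ffunE; have := h i.
case: ltrgt0P => // bi _ /eqP.
  rewrite -{1}[b 0 i]mulr1 -mulrBr mulf_eq0 gt_eqF //= => /eqP; lra.
rewrite -opprD oppr_eq0 -{1}[b 0 i]mulr1 -mulrDr mulf_eq0 lt_eqF //= => /eqP; lra.
Qed.

Lemma Ppoly_shift (x : V) c : (0 < n)%N -> @Ppoly R n x -> @Ppoly R n (x + const_mx c).
Proof.
move=> n0; rewrite Ppoly_face // => -[d h]; exists (d + c) => i; move: (h i).
by rewrite !ffunE !mxE; lra.
Qed.

Lemma face_neq0 s : face s <> set0.
Proof. by move=> h; have := face_signpt s; rewrite h. Qed.

Lemma Ppoly0 : (0 < n)%N -> @Ppoly R n 0.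
Proof. by move=> n0; rewrite Ppoly_face //; exists 0 => i; rewrite ffunE mxE; lra. Qed.

Lemma face_not0 s : s \in mixed 'I_n -> ~ face s 0.
Proof.
move=> /mixedP sm [c h]; have [i si] := sm true; have [j sj] := sm false.
by have := h i; have := h j; rewrite si sj !mxE; lra.
Qed.

Lemma sign_of_mixed (b : V) (i : 'I_n) : \sum_i b 0 i = 0 -> b 0 i != 0 ->
  sign_of b \in mixed 'I_n.
Proof.
suff pos (a : V) : \sum_i a 0 i = 0 -> a 0 i != 0 -> exists j, 0 < a 0 j.
  move=> b0 bi; apply/mixedP => -[].
    by have [j bj] := pos _ b0 bi; exists j; rewrite ffunE bj.
  have [||j] := pos (- b); first by under eq_bigr do rewrite mxE; rewrite sumrN b0 oppr0.
    by rewrite mxE oppr_eq0.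
  by rewrite mxE oppr_gt0 => bj; exists j; rewrite ffunE bj ltNge ltW.
move=> a0 ai; apply/existsP; apply: contraNT ai => /existsPn ha.
have S0 : \sum_j - a 0 j = 0 by rewrite sumrN a0 oppr0.
have h j : predT j -> 0 <= - a 0 j by move=> _; rewrite oppr_ge0 leNgt.
by have /eqP := psumr_eq0P h S0 (erefl : predT i); rewrite oppr_eq0.
Qed.

Lemma proper_faceP (F : set V) : (0 < n)%N ->
  proper_face (@Ppoly R n) F <-> exists2 s, s \in mixed 'I_n & F = face s.
Proof.
move=> n0; split.
  move=> [[E|[E|[F0 [b [c [bc FE]]]]]] [FP FN]]; [by case: FP | by case: FN | clear FN].
  have /eqP/set0P[x Fx] := F0.
  have [Px bx] : @Ppoly R n x /\ dotv b x = c by move: Fx; rewrite FE.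
  (* The maximiser [x] can be moved both ways along the all-ones vector inside the polytope, so the
     functional vanishes on that direction. *)
  have b0 : \sum_i b 0 i = 0.
    have sh d : dotv b (x + const_mx d) = c + (\sum_i b 0 i) * d.
      rewrite -bx /dotv mulr_suml -big_split; apply: eq_bigr => i _.
      by rewrite !mxE mulrDr.
    have := bc _ (Ppoly_shift 1 n0 Px); have := bc _ (Ppoly_shift (-1) n0 Px).
    by rewrite !sh; lra.
  (* The maximum is at most the l1 norm of [b], and [signpt (sign_of b)] attains that norm. *)
  have cE : c = \sum_i `|b 0 i|.
    apply/eqP; rewrite eq_le -{1}bx dotv_le_norm //=.
    have : face (sign_of b) (signpt (sign_of b)) by apply: face_signpt.
    by rewrite face_sign_of // => -[Py <-]; apply: bc.
  exists (sign_of b); last by rewrite face_sign_of // FE cE.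
  have [/existsP[i bi]|/existsPn h] := boolP [exists i, b 0 i != 0].
    exact: sign_of_mixed bi.
  have bE i : b 0 i = 0 by apply/eqP; move: (h i); rewrite negbK.
  case: FP; rewrite FE; apply/seteqP; split => y /=; first by case.
  move=> Py; split => //; rewrite cE /dotv.
  by rewrite !big1 // => i _; rewrite bE ?mul0r ?normr0.
move=> [s sm ->]; split; last split.
- right; right; split; first exact: face_neq0.
  pose w v := #|[set i | s i == Some v]%SET|.
  have w0 v : (0 < w v)%N.
    have /mixedP/(_ v)[i si] := sm.
    by apply/card_gt0P; exists i; rewrite inE si.
  (* A zero-sum functional with sign pattern [s]: each coordinate is weighted by the number of
     coordinates of opposite sign. The default in [odflt] is multiplied by 0. *)
  pose b : V := \row_i (sign_val (s i) * (w (~~ odflt true (s i)))%:R).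
  have sumw v : \sum_(i | s i == Some v) b 0 i = sign_val (Some v) * (w true)%:R * (w false)%:R.
    rewrite (eq_bigr (fun=> sign_val (Some v) * (w (~~ v))%:R)) => [|i /eqP si]; last by rewrite mxE si.
    rewrite sumr_const -[X in _ *+ X]cardsE -/(w v) -(mulr_natr (_ * _)).
    by case: v => //=; rewrite mulrAC.
  have b0 : \sum_i b 0 i = 0.
    rewrite (bigID (fun i => s i == Some true)) /= sumw (bigID (fun i => s i == Some false)) /=.
    rewrite [X in _ + (_ + X)]big1 => [|i]; last first.
      by rewrite mxE; case: (s i) => [[]|] //= _; rewrite mul0r.
    rewrite (eq_bigl (fun i => s i == Some false)) => [|i]; last by case: (s i) => [[]|].
    by rewrite sumw /= addr0 !mul1r !mulN1r mulNr subrr.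
  have -> : s = sign_of b.
    apply/ffunP => i; rewrite ffunE mxE; case: (s i) => [[]|] /=.
    + by rewrite mul1r ltr0n w0.
    + by rewrite mulN1r oppr_gt0 oppr_lt0 ltr0n w0 ltNge ler0n.
    + by rewrite mul0r ltxx.
  exists b, (\sum_i `|b 0 i|); split; last exact: face_sign_of.
  by move=> x; apply: dotv_le_norm.
- by move=> h; apply: (face_not0 sm); rewrite h; apply: Ppoly0.
- exact: face_neq0.
Qed.

Lemma affdim_uniq (S : set V) d d' : affdim S d -> affdim S d' -> d = d'.
Proof.
move=> [[M [MS <-]] Md] [[N [NS <-]] Nd].
by apply/eqP; rewrite eqn_leq Md // Nd.
Qed.

(* The projection onto the vectors constant on the support of [s], which are the
   directions of [face s]. *)
Definition dirmx s (i0 : 'I_n) : 'M[R]_n :=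
  \matrix_(i, j) (i == (if j \in supp s then i0 else j))%:R.

(** Nonzero rows occur only at [i0] and off the support, which bounds the rank above. The complement
    [1%:M - dirmx s i0] has nonzero columns only on the support without [i0], and the two ranks add
    up to at least [n]. *)
Lemma rank_dirmx s i0 : i0 \in supp s -> \rank (dirmx s i0) = (n.+1 - #|supp s|)%N.
Proof.
move=> i0S; have E := cardsC (supp s); rewrite card_ord in E.
have S0 : (0 < #|supp s|)%N by apply/card_gt0P; exists i0.
have up : (\rank (dirmx s i0) <= n.+1 - #|supp s|)%N.
  apply: leq_trans (mxrank_le_nonzero_rows (U := i0 |: ~: supp s) _) _ => [i|].
    rewrite !inE negb_or negbK => /andP[/negbTE ii0 iS]; apply/rowP => j; rewrite !mxE.
    case: ifPn => [_|jS]; first by rewrite ii0.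
    by case: eqP => // ij; rewrite -ij inE iS in jS.
  rewrite cardsU1 !inE.
  have := i0S; rewrite inE => -> /=.
  by rewrite add1n -[X in (_ <= X.+1 - _)%N]E -addnS addKn.
have down : (\rank (1%:M - dirmx s i0)%R <= #|supp s|.-1)%N.
  rewrite -mxrank_tr.
  apply: leq_trans (mxrank_le_nonzero_rows (U := supp s :\ i0) _) _ => [i|].
    rewrite finset.in_setD1 negb_and negbK => h; apply/rowP => j; rewrite !mxE.
    case: ifPn => iS; last by rewrite subrr.
    by move: h; rewrite iS orbF => /eqP ->; rewrite subrr.
  by rewrite (cardsD1 i0 (supp s)) i0S.
have := mxrank_add (dirmx s i0) (1%:M - dirmx s i0).
rewrite addrC subrK mxrank1 => D; apply/eqP; rewrite eqn_leq up leq_subLR.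
by apply: leq_ltn_trans D _; rewrite -addnS addnC leq_add2r -(prednK S0) ltnS.
Qed.

Lemma affdim_face s : s \in mixed 'I_n -> affdim (face s) (n.+1 - #|supp s|).
Proof.
move=> /mixedP/(_ true)[i0 si0]; have i0S : i0 \in supp s by rewrite inE si0.
rewrite -(rank_dirmx i0S); split.
  exists (dirmx s i0); split=> // l.
  (* Every row of [dirmx] is a difference of points of the face: row [i0] moves the centre by 1, and
     any other row leaves it at 0. *)
  exists (signpt s + row l (dirmx s i0)), (signpt s); split; last split.
  - exists (l == i0)%:R => i; rewrite !mxE inE.
    case: (s i) => [[]|] /=; rewrite ?add0r //; first by rewrite addrC.
      by rewrite addrC.
    by case: (l == i0); case: (l == i) => /=; lra.
  - exact: face_signpt.
  - by rewrite addrC addKr.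
(* Differences of points of the face are constant on the support, hence fixed by the projection. *)
move=> M MS; suff -> : M = M *m dirmx s i0 by apply: mxrankM_maxr.
apply/matrixP => l j; rewrite mxE.
rewrite (bigD1 (if j \in supp s then i0 else j)) //= mxE eqxx mulr1.
rewrite big1 ?addr0 => [|i /negbTE h]; last by rewrite mxE h mulr0.
case: ifPn => // jS; have [x [y [[c xF] [[d yF] /rowP E]]]] := MS l.
have := E j; have := E i0; rewrite !mxE => -> ->.
have := xF i0; have := yF i0; have := xF j; have := yF j; rewrite si0.
move: jS; rewrite inE; case: (s j) => [[]|] //= _; lra.
Qed.

End Geometry.

(** * From antichains of double-faces, given as lists, to antichains of sign vectors *)

Lemma InP (T : eqType) (x : T) (l : seq T) : reflect (List.In x l) (x \in l).
Proof.
elim: l => [|y l IH] /=; first by constructor.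
rewrite in_cons eq_sym; apply: (iffP orP).
  by move=> [/eqP|/IH]; [left | right].
by move=> [->|/IH]; [left | right].
Qed.

Lemma NoDupP (T : eqType) (l : seq T) : reflect (List.NoDup l) (uniq l).
Proof.
elim: l => [|x l IH] /=; first by (constructor; constructor).
apply: (iffP andP) => [[/InP xl /IH ul]|/List.NoDup_cons_iff[xl ul]].
  by apply/List.NoDup_cons_iff.
by split; [apply/InP | apply/IH].
Qed.

Section DoubleFaces.
Variables (R : realType) (n : nat).
Hypothesis n2 : (2 <= n)%N.
Local Notation V := 'rV[R]_n.
Local Notation P := (@Ppoly R n).
Local Notation signs := {ffun 'I_n -> option bool}.
Local Notation dface := (@dface R n).
Local Notation face := (@face R n).

Let n0 : (0 < n)%N. Proof. exact: ltnW. Qed.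

(** Support size [n - n %/ 3] corresponds to face dimension [(n %/ 3).+1]. *)
Let middle : {set signs} := [set s in mixed 'I_n | #|supp s| == (n - n %/ 3)%N]%SET.

Lemma card_supp_mixed (s : signs) : s \in mixed 'I_n -> (2 <= #|supp s| <= n)%N.
Proof.
move=> /mixedP sm; have := max_card (supp s); rewrite card_ord => ->; rewrite andbT.
have [i si] := sm true; have [j sj] := sm false.
have ij : i != j by apply: contra_eqN si => /eqP ->; rewrite sj.
have <- : #|[set i; j]%SET| = 2%N by rewrite cards2 ij.
by apply/subset_leq_card/fintype.subsetP => k; rewrite !inE => /orP[] /eqP ->; rewrite ?si ?sj.
Qed.

Lemma mixed_full : exists2 s : signs, s \in mixed 'I_n & #|supp s| = n.
Proof.
pose s : signs := [ffun i => Some (nat_of_ord i == 0)].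
exists s; last first.
  by rewrite -[RHS]card_ord -cardsT; apply: eq_card => i; rewrite !inE ffunE.
apply/mixedP => -[]; first by exists (Ordinal n0); rewrite ffunE.
by exists (Ordinal n2); rewrite ffunE.
Qed.

Lemma double_faceP (D : set V) :
  double_face P D <-> exists2 s, s \in mixed 'I_n & D = dface s.
Proof.
split=> [[F [/(proper_faceP _ n0)[s sm ->] ->]]|[s sm ->]]; first by exists s.
by exists (face s); split=> //; apply/(proper_faceP _ n0); exists s.
Qed.

Lemma double_faces_of_dimP d (D : set V) : double_faces_of_dim P d D <->
  exists s, [/\ s \in mixed 'I_n, D = dface s & d = (n.+1 - #|supp s|)%N].
Proof.
split=> [[F [/(proper_faceP _ n0)[s sm ->] [-> sd]]]|[s [sm -> ->]]].
  by exists s; split=> //; apply: affdim_uniq sd (affdim_face _ sm).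
exists (face s); split; first by apply/(proper_faceP _ n0); exists s.
by split=> //; apply: affdim_face.
Qed.

(** The three kinds of lattice elements have ranks in disjoint ranges, so no rank level mixes them.
    Full support gives a face of dimension 1, which puts [set0] at rank at most 0. *)
Lemma has_rankP (D : set V) r : has_rank P D r ->
  [\/ D = P /\ r = n%:Z, D = set0 /\ r <= 0 |
      0 < r < n%:Z /\ exists2 d : nat, r = d%:Z & double_faces_of_dim P d D].
Proof.
move=> [[-> ->]|[[-> [m [[_ mP] ->]]]|[F [d [Fp [DE [Fd ->]]]]]]]; first by constructor 1.
  constructor 2; split=> //; have [s sm sn] := mixed_full.
  have : (m <= n.+1 - #|supp s|)%N.
    by apply: mP (affdim_face _ sm); apply/(proper_faceP _ n0); exists s.
  by rewrite sn subSnn; lia.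
constructor 3; have Dd : double_faces_of_dim P d D by exists F.
split; last by exists d.
have /double_faces_of_dimP[s [sm _ ->]] := Dd.
by have := card_supp_mixed sm; move: #|supp s| => k; lia.
Qed.

Lemma double_faces_of_dim_antichain d (D E : set V) :
  double_faces_of_dim P d D -> double_faces_of_dim P d E -> D `<=` E -> D = E.
Proof.
move=> /double_faces_of_dimP[s [sm -> ->]] /double_faces_of_dimP[t [tm -> td]] st.
(* Support sizes are at most [n], so the truncated subtraction loses nothing and equal dimensions
   give equal sizes. *)
have := card_supp_mixed sm; have := card_supp_mixed tm => ct cs.
have [|->//|->] := @dface_sub_inj R n s t tm _ st; last by rewrite dface_sneg.
by move: (#|supp s|) (#|supp t|) td ct cs => a b; lia.
Qed.

Lemma rank_antichain r (D E : set V) :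
  has_rank P D r -> has_rank P E r -> D `<=` E -> D = E.
Proof.
move=> /has_rankP[[-> ->]|[-> r0]|[rn [d rd Dd]]] /has_rankP[[-> //]|[-> //]|[]] //; try lia.
move=> _ [e re Ed]; have de : d = e by lia.
by rewrite -de in Ed; apply: double_faces_of_dim_antichain Dd Ed.
Qed.

Lemma rank_level_antichain r (l : seq (set V)) :
  lists_exactly (rank_level P r) l -> antichain P l.
Proof.
move=> [lu lP]; split=> //; split=> [D /lP[]//|D E /lP[_ Dr] /lP[_ Er]].
exact: rank_antichain Dr Er.
Qed.

(** Each double-face comes from exactly two sign vectors, [t] and [sneg t], which differ because [t]
    is mixed. *)
Lemma card_dface_preim (l : seq (set V)) : uniq l ->
  (forall D, D \in l -> exists2 s, s \in mixed 'I_n & D = dface s) ->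
  #|[set s in mixed 'I_n | dface s \in l]%SET| = (2 * size l)%N.
Proof.
elim: l => [_ _|D l IH /= /andP[Dl lu] lP].
  by rewrite muln0; apply/eqP; rewrite cards_eq0; apply/eqP/finset.setP => s; rewrite !inE andbF.
have [t tm DE] : exists2 t, t \in mixed 'I_n & D = dface t by apply: lP; rewrite mem_head.
have -> : [set s in mixed 'I_n | dface s \in D :: l]%SET =
    ([set t; sneg t] :|: [set s in mixed 'I_n | dface s \in l])%SET.
  apply/finset.setP => s; rewrite finset.in_setU finset.in_set2 [LHS]inE [X in _ || X]inE in_cons.
  rewrite andb_orr; congr orb; rewrite DE; apply/andP/orP => [[sm /eqP E]|].
    by have [->|->] := dface_inj sm tm E; [left | right].
  by case=> /eqP ->; rewrite ?dface_sneg ?mixed_sneg tm.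
rewrite cardsU; set X := _ :&: _; have -> : X = finset.set0.
  apply/finset.setP => s; rewrite finset.in_setI finset.in_set2 finset.in_set0 [X in _ && X]inE.
  by apply/negbTE; apply: contra Dl => /and3P[/orP[] /eqP -> _]; rewrite ?dface_sneg -DE.
rewrite cards0 subn0 cards2 IH // => [|E El]; last by apply: lP; rewrite in_cons El orbT.
have -> : t != sneg t.
  by apply: contraNneq (sneg_not_le tm) => <-; apply/sleP.
by rewrite mulnS.
Qed.

(** The bound applied to the antichain of some [s] and [sneg s]; it settles the one-element
    antichains formed by [P] or [set0]. *)
Lemma two_le_middle : (2 <= #|middle|)%N.
Proof.
have [s sm _] := mixed_full; have sn := sneg_not_le sm.
have := @mixed_antichain_bound 'I_n [set s; sneg s]%SET; rewrite card_ord.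
rewrite cards2; have -> : s != sneg s.
  by apply: contraNneq sn => <-; apply/sleP.
apply=> //.
  by apply/fintype.subsetP => t; rewrite finset.in_set2 => /orP[] /eqP ->; rewrite ?mixed_sneg.
move=> x y; rewrite !inE => /orP[] /eqP -> /orP[] /eqP -> //; first by rewrite (negbTE sn).
have := @sneg_not_le _ (sneg s); rewrite mixed_sneg snegK => /(_ sm) /negbTE -> //.
Qed.

Lemma antichain_bound (B : seq (set V)) : antichain P B -> (2 * size B <= #|middle|)%N.
Proof.
move=> [/NoDupP Bu [BL BA]].
(* [P] and [set0] are comparable to every element, so an antichain containing one of them has size
   1. *)
have [/hasP[D DB top]|] := boolP (has (fun D => (D == P) || (D == set0)) B).
  suff h E : E \in B -> E = D.
    have : (size B <= size [:: D])%N by apply: uniq_leq_size => // E /h ->; rewrite mem_head.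
    by have := two_le_middle => /=; lia.
  move=> EB; have EP : E `<=` P.
    have [->|[->|/double_faceP[s _ ->]]] := BL E (elimT (InP _ _) EB) => //.
    exact: dface_sub_Ppoly.
  have {}DB := elimT (InP _ _) DB; have {}EB := elimT (InP _ _) EB.
  case/orP: top => /eqP DE; rewrite DE in DB *; first exact: BA.
  by apply/esym/BA.
move=> /hasPn Bm.
have Bd D : D \in B -> exists2 s, s \in mixed 'I_n & D = dface s.
  move=> DB; have := Bm _ DB; rewrite negb_or => /andP[/eqP DP /eqP D0].
  by have [//|[//|/double_faceP]] := BL _ (elimT (InP _ _) DB).
rewrite -(card_dface_preim Bu Bd).
have := @mixed_antichain_bound 'I_n; rewrite card_ord; apply=> //.
  by apply/fintype.subsetP => s; rewrite inE => /andP[].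
move=> s t; rewrite inE => /andP[sm sB]; rewrite inE => /andP[tm tB] st.
(* Comparable lifts give nested, hence equal, double-faces. The case [s = sneg t] is impossible,
   since a mixed vector is not below its negative. *)
have := sle_dface st => /(_ R) ts.
have E := BA _ _ (elimT (InP _ _) tB) (elimT (InP _ _) sB) ts.
have [//|tn] := dface_inj sm tm (esym E).
by have := sneg_not_le sm; rewrite {2}tn snegK st.
Qed.

(** [undup] merges the equal double-faces of [s] and [sneg s]. *)
Definition middle_faces : seq (set V) := undup [seq dface s | s <- enum middle].

Lemma middle_facesP :
  lists_exactly (double_faces_of_dim P (n %/ 3).+1) middle_faces.
Proof.
split; first by apply/NoDupP/undup_uniq.
move=> D; split.
  move=> /double_faces_of_dimP[s [sm -> sd]]; apply/InP; rewrite mem_undup.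
  apply/mapP; exists s => //; rewrite mem_enum inE sm.
  by have := card_supp_mixed sm; lia.
move=> /InP; rewrite mem_undup => /mapP[s]; rewrite mem_enum inE => /andP[sm /eqP sk] ->.
by apply/double_faces_of_dimP; exists s; split=> //; lia.
Qed.

Lemma size_middle_faces : (2 * size middle_faces = #|middle|)%N.
Proof.
have mP D : D \in middle_faces -> exists2 s, s \in middle & D = dface s.
  by rewrite mem_undup => /mapP[s]; rewrite mem_enum => sm ->; exists s.
rewrite -card_dface_preim ?undup_uniq // => [|D /mP[s]]; last first.
  by rewrite inE => /andP[sm _] ->; exists s.
apply: eq_card => s; rewrite [LHS]inE; apply/andP/idP => [[sm]|sm]; last first.
  split; first by move: sm; rewrite inE => /andP[].
  by rewrite mem_undup; apply: map_f; rewrite mem_enum.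
move=> /mP[t tm E]; have := tm; rewrite inE => /andP[tm' tk]; rewrite inE sm.
by have [->//|->] := dface_inj sm tm' E; rewrite supp_sneg.
Qed.

Lemma rank_level_middle :
  lists_exactly (rank_level P (n %/ 3).+1%:Z) middle_faces.
Proof.
have [mu mP] := middle_facesP; split=> // D; split.
  (* Since [0 < (n %/ 3).+1 < n], neither [P] nor [set0] has this rank. *)
  move=> [_ /has_rankP[[_ E]|[_ E]|[_ [d /eqP]]]]; try lia.
  by rewrite eqz_nat => /eqP <- /mP.
move=> /mP Dd; have [F [Fp [DE Fd]]] := Dd; split; first by right; right; exists F.
by right; right; exists F, (n %/ 3).+1.
Qed.

Lemma middle_faces_antichain : antichain P middle_faces.
Proof. exact: rank_level_antichain rank_level_middle. Qed.

End DoubleFaces.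

Theorem theorem3 (R : realType) (n : nat) (hn : (2 <= n)%N) :
  (* Sperner property: max antichain size = max rank-level size (= k) *)
  (exists k : nat,
     (exists (r : int) (l : list (set 'rV[R]_n)),
         lists_exactly (rank_level (@Ppoly R n) r) l /\ size l = k) /\
     (forall (r : int) (l : list (set 'rV[R]_n)),
         lists_exactly (rank_level (@Ppoly R n) r) l -> (size l <= k)%N) /\
     (exists A, antichain (@Ppoly R n) A /\ size A = k) /\
     (forall A, antichain (@Ppoly R n) A -> (size A <= k)%N)) /\
  (* the double-faces of dimension floor(n/3)+1 form a maximum antichain *)
  (exists A : list (set 'rV[R]_n),
     lists_exactly (double_faces_of_dim (@Ppoly R n) (n %/ 3).+1) A /\
     antichain (@Ppoly R n) A /\
     (forall B, antichain (@Ppoly R n) B -> (size B <= size A)%N)).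
Proof.
have bound B : antichain (@Ppoly R n) B -> (size B <= size (middle_faces R n))%N.
  by move=> /(antichain_bound hn); rewrite -(size_middle_faces R n) leq_pmul2l.
have mA := middle_faces_antichain R hn.
split; last by exists (middle_faces R n); split; first exact: middle_facesP.
exists (size (middle_faces R n)); split; [|split; [|split]] => //.
- by exists (n %/ 3).+1%:Z, (middle_faces R n); split=> //; apply: rank_level_middle.
- by move=> r l /(rank_level_antichain hn)/bound.
- by exists (middle_faces R n).
Qed.
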